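(* Every Parikh word representable graph is a bipartite permutation graph.
   Context: Let $\Sigma=\{a_1<a_2<\dots<a_s\}$ be a finite ordered alphabet and $w=w_1w_2\cdots w_n$ a nonempty word over $\Sigma$ with each $w_i\in\Sigma$. The Parikh graph $\mathcal{G}(w)$ of $w$ over $\Sigma$ is the simple undirected graph with vertex set $\{1,\dots,n\}$ in which, for $1\le i<j\le n$, the vertices $i$ and $j$ are adjacent if and only if $w_i=a_k$ and $w_j=a_{k+1}$ for some $1\le k\le s-1$. A graph $G$ is Parikh word representable if $G$ is isomorphic to $\mathcal{G}(w)$ for some nonempty word $w$ over some finite ordered alphabet. A graph $G=(V,E)$ is a permutation graph if there is an ordering $v_1,\dots,v_n$ of $V$ and a permutation $\tau$ of $\{1,\dots,n\}$ such that for all $1\le i<j\le n$, $(v_i,v_j)\in E$ if and only if $\tau(i)>\tau(j)$. A bipartite permutation graph is a graph that is both bipartite and a permutation graph. *)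

(* Defs.v *)
From mathcomp Require Import all_boot all_order all_fingroup.

Set Implicit Arguments.
Unset Strict Implicit.
Unset Printing Implicit Defensive.

Record sgraph := SGraph {
  vertex :> finType;
  edge : rel vertex;
  edge_sym : symmetric edge;
  edge_irrefl : irreflexive edge }.

Definition graph_iso (G H : sgraph) : Prop :=
  exists2 f : G -> H, bijective f & forall x y, edge (f x) (f y) = edge x y.

(* An ordered alphabet a_1 < ... < a_s is a [finOrderType]; [Order.enum_rank]
   sends a_k to k - 1, its index in the increasing enumeration. *)
Definition next_letter d (Sigma : finOrderType d) : rel Sigma :=
  fun a b => Order.enum_rank b == (Order.enum_rank a).+1 :> nat.

Section ParikhGraph.
Variables (d : Order.disp_t) (Sigma : finOrderType d).
Variables (n : nat) (w : n.-tuple Sigma).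

Definition parikh_arc : rel 'I_n :=
  fun i j => (i < j) && next_letter (tnth w i) (tnth w j).

Definition parikh_edge : rel 'I_n :=
  fun i j => parikh_arc i j || parikh_arc j i.

Lemma parikh_edge_sym : symmetric parikh_edge.
Proof. by move=> i j; rewrite /parikh_edge orbC. Qed.

Lemma parikh_edge_irrefl : irreflexive parikh_edge.
Proof. by move=> i; rewrite /parikh_edge /parikh_arc ltnn. Qed.

Definition parikh_graph : sgraph := SGraph parikh_edge_sym parikh_edge_irrefl.

End ParikhGraph.

Definition parikh_word_representable (G : sgraph) : Prop :=
  exists (d : Order.disp_t) (Sigma : finOrderType d) (n : nat)
         (w : n.-tuple Sigma),
    0 < n /\ graph_iso G (parikh_graph w).

(* The color classes may be empty, so edgeless graphs are bipartite. *)
Definition bipartite (G : sgraph) : Prop :=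
  exists c : G -> bool, forall x y, edge x y -> c x != c y.

Definition permutation_graph (G : sgraph) : Prop :=
  exists (v : 'I_#|G| -> G) (tau : 'S_#|G|),
    bijective v /\
    forall i j : 'I_#|G|, i < j -> edge (v i) (v j) = (tau j < tau i).

Definition bipartite_permutation_graph (G : sgraph) : Prop :=
  bipartite G /\ permutation_graph G.

(* Main.v *)
(* Write (k, p) for an occurrence at position p of the letter of index k, and
   order the vertices of the Parikh graph in two ways: lexicographically by
   increasing ceil(k/2) then decreasing p, and lexicographically by increasing
   floor(k/2) then decreasing p. The letters k and k+1 share a block in exactly
   one of the two orders, so the orders disagree on (k, p) and (k+1, q) exactly
   when p < q; they agree on all pairs of letters that are not consecutive.
   The parity of k is a proper 2-coloring. *)
Require Import Defs.
From mathcomp Require Import all_boot all_order all_fingroup.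
From mathcomp Require Import zify.

Set Implicit Arguments.
Unset Strict Implicit.
Unset Printing Implicit Defensive.

(** The rank of [x] counts the elements with smaller [f]-value; injectivity of [f] excludes ties, so
    ranks are distinct. *)
Lemma order_rank_exists (T : finType) (f : T -> nat) : injective f ->
  exists2 r : T -> 'I_#|T|, bijective r & forall x y, (r x < r y) = (f x < f y).
Proof.
move=> f_inj; pose below x := [set y | f y < f x].
have below_lt x : #|below x| < #|T|.
  by rewrite -cardsT proper_card // properT; apply/eqP=> /setP/(_ x);
    rewrite !inE ltnn.
pose r x := Ordinal (below_lt x).
have r_homo x y : f x < f y -> r x < r y.
  move=> lt_xy; apply/proper_card/properP; split.
    by apply/subsetP=> z; rewrite !inE => /ltn_trans; apply.
  by exists x; rewrite !inE ?ltnn.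
have r_mono x y : (r x < r y) = (f x < f y).
  case: (ltngtP (f x) (f y)) => [/r_homo // | /r_homo /ltnW | /f_inj ->].
    by rewrite leqNgt => /negbTE.
  by rewrite ltnn.
exists r => //; apply: inj_card_bij; last by rewrite card_ord.
move=> x y eq_r; apply: f_inj.
have := r_mono x y; have := r_mono y x.
by rewrite eq_r ltnn; case: ltngtP.
Qed.

(** [v] lists the vertices by increasing [f], and [tau] sends an [f]-rank to the [g]-rank of the
    same vertex, so its inversions are the edges. *)
Lemma permutation_graph_of_orders (G : sgraph) (f g : G -> nat) :
    injective f -> injective g ->
    (forall x y, f x < f y -> edge x y = (g y < g x)) ->
  permutation_graph G.
Proof.
move=> /order_rank_exists[rf [v rfK vK] rf_mono].
move=> /order_rank_exists[rg rg_bij rg_mono] edgeE.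
have tau_inj : injective (rg \o v).
  by apply: inj_comp (bij_inj rg_bij) (can_inj vK).
exists v, (perm tau_inj); split; first by exists rf.
by move=> i j lt_ij; rewrite !permE rg_mono edgeE // -rf_mono !vK.
Qed.

(** For [p < n] the second summand is below [n], so keys compare lexicographically: by increasing
    [b], then by decreasing [p]. *)
Definition block_key (n b p : nat) := b * n + (n.-1 - p).

Lemma ltn_block_key n b c p q : p < n -> q < n ->
  (block_key n b p < block_key n c q) = (b < c) || (b == c) && (q < p).
Proof.
rewrite /block_key => lt_p lt_q.
case: (ltngtP b c) => [lt_bc | lt_cb | ->] /=; [|apply/negbTE; rewrite -leqNgt|lia].
  have : b.+1 * n <= c * n by rewrite leq_mul2r lt_bc orbT.
  by rewrite mulSn; lia.
have : c.+1 * n <= b * n by rewrite leq_mul2r lt_cb orbT.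
by rewrite mulSn; lia.
Qed.

Lemma block_key_inj n (b : 'I_n -> nat) :
  injective (fun i : 'I_n => block_key n (b i) i).
Proof.
move=> i j eq_key; apply/val_inj/eqP => /=.
have := ltn_block_key (b i) (b j) (ltn_ord i) (ltn_ord j).
have := ltn_block_key (b j) (b i) (ltn_ord j) (ltn_ord i).
by rewrite eq_key ltnn; lia.
Qed.

Theorem theorem4p4 (G : sgraph) :
  parikh_word_representable G -> bipartite_permutation_graph G.
Proof.
move=> [d [Sigma [n [w [_ [h /bij_inj h_inj hE]]]]]].
pose k i : nat := Order.enum_rank (tnth w i).
have edgeE x y : edge x y =
    (h x < h y) && (k (h y) == (k (h x)).+1)
    || (h y < h x) && (k (h x) == (k (h y)).+1).
  by rewrite -hE.
split.
  exists (fun x => odd (k (h x))) => x y; rewrite edgeE.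
  by case/orP=> /andP[_ /eqP->] /=; case: (odd _).
apply: (@permutation_graph_of_orders G
  (fun x => block_key n (uphalf (k (h x))) (h x))
  (fun x => block_key n (k (h x))./2 (h x))).
- exact: inj_comp (@block_key_inj n (fun i => uphalf (k i))) h_inj.
- exact: inj_comp (@block_key_inj n (fun i => (k i)./2)) h_inj.
move=> x y; rewrite !ltn_block_key // edgeE.
move: (k (h x)) (k (h y)) (nat_of_ord (h x)) (nat_of_ord (h y)) => a b p q.
(* Splitting [a] and [b] into half and parity makes the claim linear. *)
by rewrite !uphalf_half; have := odd_double_half a; have := odd_double_half b; lia.
Qed.
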